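(* Let $(X,T,d)$ be a topological dynamical system and let $\Omega(T)$ be its set of non-wandering points. Then $$\mathrm{mdim}_{\mathrm A}(X,T,d)=\mathrm{mdim}_{\mathrm A}(\Omega(T),T,d).$$
   Context: A topological dynamical system $(X,T,d)$ is a compact metric space $(X,d)$ with a homeomorphism $T:X\to X$. A point $x\in X$ is non-wandering if for every open neighbourhood $U$ of $x$ there exists $n\ge1$ such that $T^nU\cap U\ne\emptyset$. The set $\Omega(T)$ of non-wandering points is compact and $T$-invariant, and $(\Omega(T),T,d)$ denotes the restricted system. For $M\in\mathbb N=\{1,2,\dots\}$ put $d_M(x,y)=\max_{0\le m<M}d(T^mx,T^my)$ and $B_{d_M}(x,r)=\{y\in X: d_M(x,y)\le r\}$. For a metric $d$, a subset $K$ and $\varepsilon>0$, $N_d(K,\varepsilon)$ is the minimal $n\ge1$ such that $K$ can be covered by $n$ open sets of $d$-diameter at most $\varepsilon$. For $0<\rho<r$ let $$S(X,r,\rho)=\lim_{M\to\infty}\frac1M\sup_{x\in X}\log N_{d_M}(B_{d_M}(x,r),\rho)$$ (the limit exists by sub-additivity). The mean Assouad dimension is $$\mathrm{mdim}_{\mathrm A}(X,T,d)=\inf\{s>0:\exists C>0\ \forall\, 0<\rho<r,\ e^{S(X,r,\rho)}\le C(r/\rho)^s\}$$ (with $\inf\emptyset=+\infty$). *)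

(* Defs.v *)
From HB Require Import structures.
From mathcomp Require Import all_boot all_order all_algebra.
From mathcomp Require Import all_classical all_reals all_analysis.

Set Implicit Arguments.
Unset Strict Implicit.
Unset Printing Implicit Defensive.

Import Order.TTheory GRing.Theory Num.Theory.
Import numFieldNormedType.Exports.

Local Open Scope classical_set_scope.
Local Open Scope ring_scope.

(* The library puts the induced topology and pseudometric on a subtype; here we
   record that the restricted distance is a metric for it. *)
Section subtype_metric.
Context {R : realType} {X : metricType R} (A : set X).

Definition sub_mdist (x y : A) : R := mdist (set_val x) (set_val y).

Let sub_mdist_ge0 x y : 0 <= sub_mdist x y.
Proof. exact: mdist_ge0. Qed.

Let sub_mdist_positivity x y : sub_mdist x y = 0 -> x = y.
Proof. by move=> /mdist_positivity; exact: val_inj. Qed.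

Let sub_ballE (x : A) (e : R) : ball x e = [set y | sub_mdist x y < e].
Proof. by rewrite -initial_ballE ballEmdist. Qed.

HB.instance Definition _ := PseudoMetric_isMetric.Build R (set_type A)
  sub_mdist_ge0 sub_mdist_positivity sub_ballE.

End subtype_metric.

Section homeomorphism.
Context {X Y : topologicalType}.

Definition homeomorphism (f : X -> Y) : Prop :=
  continuous f /\
  exists g : Y -> X, [/\ continuous g, cancel f g & cancel g f].

End homeomorphism.

Record dynSystem (R : realType) := DynSystem {
  dyn_space :> metricType R ;
  dyn_map : dyn_space -> dyn_space ;
  dyn_compact : compact [set: dyn_space] ;
  dyn_homeo : homeomorphism dyn_map }.

Section nonwandering.
Context {R : realType} (X : dynSystem R).
Let T := @dyn_map R X.

Definition nonwandering : set X := [set x |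
  forall U : set X, open U -> U x ->
    exists2 n : nat, (1 <= n)%N & (iter n T @` U) `&` U !=set0].

Lemma nonwandering_closed : closed nonwandering.
Proof.
move=> x clx U oU Ux.
have [y [Oy Uy]] := clx _ (open_nbhs_nbhs (conj oU Ux)).
exact: Oy.
Qed.

Lemma nonwandering_commute (g : X -> X) : continuous g ->
  (forall x, g (T x) = T (g x)) ->
  forall x, nonwandering x -> nonwandering (g x).
Proof.
move=> cg gT x Ox V oV Vgx.
have [|//|n n1 [_ [[u Vgu <-] VgTu]]] := Ox (g @^-1` V).
  by apply: open_comp => // y _; exact: cg.
exists n => //; exists (g (iter n T u)); split=> //; exists (g u) => //.
by elim: n {n1 VgTu} => //= n ->; rewrite gT.
Qed.

Lemma nonwandering_map x : nonwandering x -> nonwandering (T x).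
Proof. by apply: nonwandering_commute => //; case: (dyn_homeo X). Qed.

Definition nonwandering_fun (x : nonwandering) : nonwandering :=
  exist _ (T (set_val x)) (mem_set (nonwandering_map (set_valP x))).

Lemma nonwandering_fun_homeo : homeomorphism nonwandering_fun.
Proof.
have sub_cont (h : nonwandering -> nonwandering) (k : X -> X) :
    continuous k -> (forall x, set_val (h x) = k (set_val x)) -> continuous h.
  move=> ck hk; apply: (@continuous_comp_initial _ _ _ set_val).
  have -> : set_val \o h = k \o set_val by apply/funext => x; exact: hk.
  by move=> x; apply: continuous_comp; [exact: initial_continuous|exact: ck].
have [cT [g [cg gK Kg]]] := dyn_homeo X.
have gT x : g (T x) = T (g x) by rewrite gK; exact: esym (Kg x).
pose h (x : nonwandering) : nonwandering :=
  exist _ (g (set_val x)) (mem_set (nonwandering_commute cg gT (set_valP x))).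
split; first exact: (sub_cont _ T).
exists h; split; first exact: (sub_cont _ g).
- by move=> x; apply: val_inj => /=; exact: gK.
- by move=> x; apply: val_inj => /=; exact: Kg.
Qed.

Lemma nonwandering_compact : compact [set: nonwandering].
Proof.
have cO : compact nonwandering.
  exact: subclosed_compact nonwandering_closed (@dyn_compact R X) _.
move=> F PF _.
have [|p [Op clp]] := cO (set_val @ F) _.
  by apply: (@filterS _ F _ setT) filterT => x _; exact: set_valP.
exists (exist _ p (mem_set Op)); split=> // A B FA [_ [[W oW <-] /= Wp WB]].
have [||_ [[a Aa <-] Wa]] := clp (set_val @` A) W.
- by apply: (@filterS _ F _ A) FA => a Aa; exists a.
- exact: open_nbhs_nbhs.
by exists a; split=> //; exact: WB.
Qed.

Definition nonwandering_system : dynSystem R :=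
  DynSystem nonwandering_compact nonwandering_fun_homeo.

End nonwandering.

Section covering_number.
Context {R : realType} {X : topologicalType}.
Local Open Scope ereal_scope.

Definition diam (d : X -> X -> R) (A : set X) : \bar R :=
  ereal_sup [set (d x y)%:E | x in A & y in A].

Definition open_coverable (d : X -> X -> R) (K : set X) (e : R) (n : nat) :=
  exists U : 'I_n -> set X,
    [/\ forall i, open (U i), forall i, diam d (U i) <= e%:E
      & K `<=` \bigcup_i U i].

(* An infimum over a set of naturals, hence attained as soon as some finite
   cover exists, and +oo otherwise. Openness refers to the topology of X, so d
   is meant to be a metric inducing it, as bowen_dist M below does for M >= 1. *)
Definition covering_number (d : X -> X -> R) (K : set X) (e : R) : \bar R :=
  ereal_inf [set (n%:R)%:E | n in
    [set n : nat | (1 <= n)%N /\ open_coverable d K e n]].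

End covering_number.

Section mean_assouad_dimension.
Context {R : realType} (X : dynSystem R).
Let T := @dyn_map R X.

(* Only M >= 1 is meaningful; the term M = 0 does not affect local_entropy. *)
Definition bowen_dist (M : nat) (x y : X) : R :=
  \big[Num.max/0]_(m < M) mdist (iter m T x) (iter m T y).

Definition bowen_ball (M : nat) (x : X) (r : R) : set X :=
  [set y | bowen_dist M x y <= r].

Local Open Scope ereal_scope.

Definition local_entropy (r rho : R) : \bar R :=
  limn (fun M : nat => (M%:R^-1)%:E *
    ereal_sup [set lne (covering_number (bowen_dist M) (bowen_ball M x r) rho)
              | x in [set: X]]).

Definition mdimA : \bar R :=
  ereal_inf [set s%:E | s in [set s : R | (0 < s)%R /\
    exists2 C : R, (0 < C)%R & forall r rho : R, (0 < rho < r)%R ->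
      expeR (local_entropy r rho) <= (C * (r / rho) `^ s)%:E]].

End mean_assouad_dimension.

(* Main.v *)
Require Import Defs.
From mathcomp Require Import all_boot all_order all_algebra.
From mathcomp Require Import all_classical all_reals all_analysis.
From mathcomp Require Import ring lra.

Set Implicit Arguments.
Unset Strict Implicit.
Unset Printing Implicit Defensive.

Import Order.TTheory GRing.Theory Num.Theory.
Import numFieldNormedType.Exports.

Local Open Scope classical_set_scope.
Local Open Scope ring_scope.

(** Write Om for the non-wandering set, d_M for the Bowen metrics and S(r, rho)
    for the local entropy. Everything rests on two comparisons: S of Om at
    (r, rho) is at most S of X at (r, rho), and S of X at (r, rho) is at most
    S of Om at (2r, rho/2). The change of scale multiplies r / rho by 4, so it
    only turns the constant C of the definition of the mean Assouad dimension
    into C 4^s, and the same exponents s are admissible for both systems.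

    The first comparison ([local_entropy_nonwandering_le]) is the restriction of
    covers to Om. For the second ([local_entropy_le_nonwandering]), fix a window
    length L, put h = rho/8 and let U be the open d_L-neighbourhood of radius h
    of Om. The complement of U is compact and made of wandering points, hence
    covered by finitely many sets each of which an orbit meets at most once: so
    an orbit lies outside U at most k times, with k uniform
    ([wandering_escape_bounded]). Cut [0, nL) into n windows of length L. If x
    and y are both in U at the start of a window and stay r-close during it, they
    are followed for that window by points of Om which are (r + 2h)-close, so the
    possible y are covered by G0 = exp (log growth of Om at length L) pieces
    ([small_pieces_near_nonwandering]). The other windows are at most 2k, and each
    costs a constant factor K, the number of pieces needed for the whole of X.
    Where they occur among the n windows is not known, but this costs only a
    subexponential factor ([small_pieces_bowen_ball_windows]). Letting n tend to
    infinity gives S_X(r, rho) <= (log G0) / L, and it remains to take the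
    infimum over L.

    The limits over M are handled by Fekete's lemma: the logarithmic growth is
    subadditive in M ([log_growthD]), so the limit exists and is the infimum of
    the rates; this is what allows one to use the lengths nL only, and each L
    separately. For counting, open covers are traded for labellings whose classes
    are small ([small_pieces]); these combine without any care for openness,
    which is restored at the end by a small thickening of the classes. *)

(** * Fekete's lemma *)

Section fekete.
Context {R : realType} (u : nat -> R).
Hypothesis u_ge0 : forall n, 0 <= u n.
Hypothesis u_sub : forall m n, u (m + n)%N <= u m + u n.

Let rate_ge0 : lbound [set u n / n%:R | n in [set n | (0 < n)%N]] 0.
Proof. by move=> _ [n _ <-]; apply: divr_ge0. Qed.

Lemma fekete_inf_le n : (0 < n)%N ->
  inf [set u n / n%:R | n in [set n | (0 < n)%N]] <= u n / n%:R.
Proof. by move=> n0; apply: ge_inf; [exists 0|exists n]. Qed.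

Lemma le_fekete_inf c : (forall n, (0 < n)%N -> c <= u n / n%:R) ->
  c <= inf [set u n / n%:R | n in [set n | (0 < n)%N]].
Proof.
move=> h; apply: lb_le_inf; first by exists (u 1%N / 1%:R); exists 1%N.
by move=> _ [n n0 <-]; exact: h.
Qed.

Let u_mull q p : u (q * p)%N <= u 0%N + q%:R * u p.
Proof.
elim: q => [|q IH]; first by rewrite mul0n mul0r addr0.
rewrite mulSn (le_trans (u_sub _ _))// -addn1 natrD mulrDl mul1r.
by rewrite addrC addrA lerD2r.
Qed.

(** If the rate at p is within e/2 of the infimum, then writing n = q p + s with
    s < p gives u n <= q u(p) + O(1), so the rate at n is eventually within e. *)
Lemma fekete : u n / n%:R @[n --> \oo] -->
  inf [set u n / n%:R | n in [set n | (0 < n)%N]].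
Proof.
set l := inf _.
apply/cvgrPdist_le => e e0.
have [_ [p p0 <-] lp] : exists2 x, [set u n / n%:R | n in [set n | (0 < n)%N]] x
    & x < l + e / 2.
  apply: inf_adherent; first by rewrite divr_gt0.
  by split; [exists (u 1%N / 1%:R), 1%N|exists 0].
pose C := 2 * u 0%N + p%:R * u 1%N.
have C0 : 0 <= C by rewrite /C addr_ge0// mulr_ge0.
near=> n.
have n0 : (0 < n)%N by near: n; exact: nbhs_infty_gt.
have nR : 0 < n%:R :> R by rewrite ltr0n.
rewrite distrC ger0_norm ?subr_ge0 ?fekete_inf_le// lerBlDl.
have pR : 0 < p%:R :> R by rewrite ltr0n.
have un : u n <= n%:R * (u p / p%:R) + C.
  rewrite {1}(divn_eq n p) (le_trans (u_sub _ _))//.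
  rewrite (le_trans (lerD (u_mull _ _) (lexx _)))//.
  have us : u (n %% p)%N <= u 0%N + p%:R * u 1%N.
    have := u_mull (n %% p) 1; rewrite muln1 => /le_trans; apply.
    by rewrite lerD2l ler_wpM2r// ler_nat ltnW// ltn_mod.
  have qn : (n %/ p)%:R * u p <= n%:R * (u p / p%:R).
    rewrite mulrCA mulrC ler_wpM2l//.
    by rewrite ler_pdivlMr// -natrM ler_nat leq_divM.
  by rewrite /C; lra.
have Cn : C <= n%:R * (e / 2).
  have : C / (e / 2) <= n%:R by near: n; exact: nbhs_infty_ger.
  by rewrite ler_pdivrMr// divr_gt0.
rewrite ler_pdivrMr//; apply: (le_trans un).
have : n%:R * (u p / p%:R) <= n%:R * (l + e / 2) by rewrite ler_wpM2l// ltW.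
lra.
Unshelve. all: by end_near.
Qed.

End fekete.

(** * Finite families of small pieces *)

(** Compactness in terms of finite subcovers, for a space that may be empty. If
    no finite set s of points worked, the complements of the unions of the V y,
    y in s, would generate a filter on K without cluster point. *)
Lemma compact_finite_subfamily (T : topologicalType) (K : set T)
    (V : T -> set T) : compact K -> (forall x, K x -> nbhs x (V x)) ->
  exists s : seq T, forall x, K x -> exists2 y, y \in s & V y x.
Proof.
move=> cK KV; apply: contrapT => /forallNP noS.
pose B (s : seq T) := K `&` [set x | ~ exists2 y, y \in s & V y x].
pose F := filter_from [set: seq T] B.
have PF : ProperFilter F.
  apply: filter_from_proper.
    apply: filter_from_filter; first by exists [::].
    move=> s t _ _; exists (s ++ t) => // x [Kx h]; split; split=> // -[y ys Vy];
      by apply: h; exists y => //; rewrite mem_cat ys ?orbT.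
  by move=> s _; have /existsNP[x /not_implyP[Kx h]] := noS s; exists x.
have FK : F K by exists [::] => // x [].
have [p [Kp clp]] := cK F PF FK.
have [|x [[_ h] Vx]] := clp (B [:: p]) (V p) _ (KV p Kp); first by exists [:: p].
by apply: h; exists p => //; rewrite mem_head.
Qed.

Section small_pieces.
Context {R : realType}.

(** At most B pieces of d-size e cover E. A piece is the class of a label, so the
    pieces need no regularity and products or unions of families are obtained by
    arithmetic on labels; the bound B is real because it will be an
    exponential. *)
Definition small_pieces (X : Type) (d : X -> X -> R) (E : set X) (e B : R) :=
  exists2 n : nat, n%:R <= B & exists c : X -> nat,
    (forall y, E y -> (c y < n)%N) /\
    (forall y z, E y -> E z -> c y = c z -> d y z <= e).

Lemma small_pieces0 (X : Type) (d : X -> X -> R) (E : set X) (e B : R) :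
  0 <= B -> E `<=` set0 -> small_pieces d E e B.
Proof.
move=> B0 E0; exists 0%N => //; exists (fun=> 0%N).
by split=> [y Ey|y z Ey]; case: (E0 y Ey).
Qed.

Lemma small_pieces1 (X : Type) (d : X -> X -> R) (E : set X) (e B : R) :
  1 <= B -> (forall y z, E y -> E z -> d y z <= e) -> small_pieces d E e B.
Proof. by move=> B1 Ed; exists 1%N => //; exists (fun=> 0%N); split=> // y z Ey Ez _; exact: Ed. Qed.

Lemma small_pieces_le (X : Type) (d : X -> X -> R) (E : set X) (e B B' : R) :
  B <= B' -> small_pieces d E e B -> small_pieces d E e B'.
Proof. by move=> BB' [n nB cP]; exists n => //; exact: le_trans BB'. Qed.

Lemma small_pieces_preimage (X Y : Type) (f : X -> Y) (d : Y -> Y -> R)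
    (E : set Y) (e B : R) : small_pieces d E e B ->
  small_pieces (fun x x' => d (f x) (f x')) (f @^-1` E) e B.
Proof.
move=> [n nB [c [cn cd]]]; exists n => //; exists (c \o f).
by split=> [y|y z]; [exact: cn|exact: cd].
Qed.

Lemma small_piecesU (X : Type) (d : X -> X -> R) (E E1 E2 : set X)
    (e B1 B2 : R) : E `<=` E1 `|` E2 ->
  small_pieces d E1 e B1 -> small_pieces d E2 e B2 ->
  small_pieces d E e (B1 + B2).
Proof.
move=> EE [n1 nB1 [c1 [cn1 cd1]]] [n2 nB2 [c2 [cn2 cd2]]].
exists (n1 + n2)%N; first by rewrite natrD lerD.
exists (fun y => if pselect (E1 y) then c1 y else (n1 + c2 y)%N); split.
- move=> y /EE Ey; case: pselect => [E1y|nE1y]; first by rewrite ltn_addr// cn1.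
  by case: Ey => // /cn2; rewrite ltn_add2l.
- move=> y z /EE Ey /EE Ez.
  case: pselect => [E1y|nE1y]; case: pselect => [E1z|nE1z].
  + exact: cd1.
  + by move=> /= h; have := cn1 _ E1y; rewrite h ltnNge leq_addr.
  + by move=> /= h; have := cn1 _ E1z; rewrite -h ltnNge leq_addr.
  + by case: Ey => // E2y; case: Ez => // E2z /= /addnI; exact: cd2.
Qed.

Lemma small_piecesI (X : Type) (d d1 d2 : X -> X -> R) (E1 E2 : set X)
    (e B1 B2 : R) :
  (forall y z, d1 y z <= e -> d2 y z <= e -> d y z <= e) ->
  small_pieces d1 E1 e B1 -> small_pieces d2 E2 e B2 ->
  small_pieces d (E1 `&` E2) e (B1 * B2).
Proof.
move=> dd [n1 nB1 [c1 [cn1 cd1]]] [n2 nB2 [c2 [cn2 cd2]]].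
exists (n1 * n2)%N; first by rewrite natrM ler_pM.
exists (fun y => (c1 y * n2 + c2 y)%N); split.
- move=> y [/cn1 lt1 /cn2 lt2].
  by rewrite (@leq_trans ((c1 y).+1 * n2))// ?leq_mul2r ?lt1 ?orbT// mulSn addnC ltn_add2r.
- move=> y z [E1y E2y] [E1z E2z] h.
  have [l1 l2] := (cn2 _ E2y, cn2 _ E2z).
  have n20 : (0 < n2)%N by exact: leq_ltn_trans l1.
  apply: dd; [apply: cd1 => //|apply: cd2 => //].
  + by have := congr1 (divn^~ n2) h; rewrite !divnMDl// !divn_small// !addn0.
  + by have := congr1 (modn^~ n2) h; rewrite !modnMDl !modn_small.
Qed.

End small_pieces.

(** * Covering numbers *)

Section covering.
Context {R : realType} {X : topologicalType}.
Implicit Types (d : X -> X -> R) (K : set X).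

(** The diameter of the empty set is -oo, which is why e may be negative. *)
Lemma diam_leP d (A : set X) e :
  (diam d A <= e%:E)%E <-> (forall x y, A x -> A y -> d x y <= e).
Proof.
split=> [/ereal_supP h x y Ax Ay|h].
  by rewrite -lee_fin; apply: h; exists x => //; exists y.
by apply/ereal_supP => _ [x Ax [y Ay <-]]; rewrite lee_fin; exact: h.
Qed.

Lemma open_coverable_fin d K e (I : finType) (U : I -> set X) :
  (forall i, open (U i)) -> (forall i x y, U i x -> U i y -> d x y <= e) ->
  K `<=` \bigcup_i U i -> open_coverable d K e #|I|.
Proof.
move=> oU dU KU; exists (U \o enum_val); split=> [i|i|x /KU [i _ Ui]].
- exact: oU.
- by apply/diam_leP; exact: dU.
- by exists (enum_rank i) => //=; rewrite enum_rankK.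
Qed.

(** The infimum defining the covering number is over naturals, hence attained as
    soon as it is not +oo. *)
Lemma covering_number_leP d K e (b : R) :
  (covering_number d K e <= b%:E)%E <->
  exists n : nat, [/\ (1 <= n)%N, n%:R <= b & open_coverable d K e n].
Proof.
split; last first.
  move=> [n [n1 nb cn]]; apply: (@le_trans _ _ n%:R%:E); last by rewrite lee_fin.
  by apply: ereal_inf_lbound; exists n.
rewrite /covering_number.
set S := [set n | _ /\ _].
have [[m Sm]|/forallNP S0] := pselect (exists n, S n); last first.
  rewrite (_ : [set _ | _ in S] = set0) ?ereal_inf0 ?leye_eq//.
  by apply/seteqP; split=> // y [n Sn _]; case: (S0 n).
have exS : exists n, `[< S n >] by exists m; exact/asboolP.
case: (ex_minnP exS) => n /asboolP[n1 cn] nmin hb; exists n; split=> //.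
rewrite -lee_fin; apply: le_trans hb.
by apply/ereal_infP => _ [k Sk <-]; rewrite lee_fin ler_nat; apply: nmin; exact/asboolP.
Qed.

Lemma covering_number_ge1 d K e : (1 <= covering_number d K e)%E.
Proof. by apply/ereal_infP => _ [n [n1 _] <-]; rewrite lee_fin ler1n. Qed.

Lemma small_pieces_open_coverable d K e n :
  open_coverable d K e n -> small_pieces d K e n%:R.
Proof.
move=> [U [_ dU KU]]; exists n => //.
(* When n = 0 there is no set to choose, but then K is empty. *)
have [i0|/forallNP no] := pselect (exists i : 'I_n, True); last first.
  by exists (fun=> 0%N); split=> [y Ky|y z Ky]; have [i] := KU y Ky; have := no i.
have [c cU] : {c : X -> 'I_n & forall y, K y -> U (c y) y}.
  apply: (@choice _ _ (fun y i => K y -> U i y)) => y.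
  have [/KU [i _ Ui]|nK] := pselect (K y); first by exists i.
  by case: i0 => i _; exists i.
exists (fun y => nat_of_ord (c y)); split=> [y _|y z Ky Kz /val_inj cyz].
  exact: ltn_ord.
by have /diam_leP := dU (c y); apply; [|rewrite cyz]; exact: cU.
Qed.

End covering.

(** * Bowen metrics *)

Lemma mdist_ball_open (R : realType) (X : metricType R) (x : X) (e : R) :
  open [set y | mdist x y < e].
Proof.
rewrite openE => y /= xye; apply/nbhs_ballP; exists (e - mdist x y) => /=.
  by rewrite subr_gt0.
rewrite ballEmdist => z /= yz.
by rewrite (le_lt_trans (metric_triangle _ y _))// -ltrBrDl.
Qed.

Section bowen.
Context {R : realType} {X : dynSystem R}.
Let T := @dyn_map R X.
Implicit Types (x y z : X) (M N : nat).

(* The maximum defining bowen_dist starts at 0, whence the bounds on e. *)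

Lemma bowen_dist_leP M x y e :
  bowen_dist M x y <= e <->
  0 <= e /\ forall m, (m < M)%N -> mdist (iter m T x) (iter m T y) <= e.
Proof.
split=> [/bigmax_leP[e0 h]|[e0 h]].
  by split=> // m mM; exact: (h (Ordinal mM)).
by apply/bigmax_leP; split=> // i _; exact: h.
Qed.

Lemma bowen_dist_ltP M x y e :
  bowen_dist M x y < e <->
  0 < e /\ forall m, (m < M)%N -> mdist (iter m T x) (iter m T y) < e.
Proof.
split=> [/bigmax_ltP[e0 h]|[e0 h]].
  by split=> // m mM; exact: (h (Ordinal mM)).
by apply/bigmax_ltP; split=> // i _; exact: h.
Qed.

Lemma bowen_dist_ge0 M x y : 0 <= bowen_dist M x y.
Proof. by have [] := (bowen_dist_leP M x y (bowen_dist M x y)).1 (lexx _). Qed.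

Lemma bowen_distxx M x : bowen_dist M x x = 0.
Proof.
apply/eqP; rewrite eq_le bowen_dist_ge0 andbT.
by apply/bowen_dist_leP; split=> // m _; rewrite mdistxx.
Qed.

Lemma bowen_dist_sym M x y : bowen_dist M x y = bowen_dist M y x.
Proof. by apply: eq_bigr => m _; rewrite metric_sym. Qed.

Lemma bowen_dist_triangle M y x z :
  bowen_dist M x z <= bowen_dist M x y + bowen_dist M y z.
Proof.
apply/bowen_dist_leP; split=> [|m mM]; first by rewrite addr_ge0 ?bowen_dist_ge0.
apply: le_trans (metric_triangle _ (iter m T y) _) _; apply: lerD.
- by have [_] := (bowen_dist_leP M x y _).1 (lexx _); exact.
- by have [_] := (bowen_dist_leP M y z _).1 (lexx _); exact.
Qed.

Lemma bowen_distD_leP M N x y e :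
  bowen_dist (M + N) x y <= e <->
  bowen_dist M x y <= e /\ bowen_dist N (iter M T x) (iter M T y) <= e.
Proof.
split=> [/bowen_dist_leP[e0 h]|[/bowen_dist_leP[e0 h] /bowen_dist_leP[_ k]]].
  split; apply/bowen_dist_leP; split=> // m mM.
    by apply: h; rewrite ltn_addr.
  by rewrite -!iterD addnC; apply: h; rewrite ltn_add2l.
apply/bowen_dist_leP; split=> // m mMN.
have [mM|Mm] := ltnP m M; first exact: h.
rewrite -(subnK Mm) !iterD; apply: k.
by rewrite ltn_subLR.
Qed.

Lemma iter_continuous m : continuous (iter m T : X -> X).
Proof.
have [cT _] := dyn_homeo X.
elim: m => [|m IH] x; first exact: cvg_id.
by apply: (@continuous_comp _ _ _ (iter m T) T); [exact: IH|exact: (cT (iter m T x))].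
Qed.

Lemma bowen_ball_open M x e : open [set y | bowen_dist M x y < e].
Proof.
have [e0|e0] := ltP 0 e; last first.
  rewrite (_ : [set y | _] = set0); first exact: open0.
  apply/seteqP; split=> // y /= /lt_le_trans /(_ e0).
  by rewrite ltNge bowen_dist_ge0.
rewrite (_ : [set y | _] =
    \bigcap_(m < M) (iter m T @^-1` [set y | mdist (iter m T x) y < e])).
  rewrite bigcap_mkord; elim/big_ind: _ => [|A B|m _]; [exact: openT|exact: openI|].
  apply: open_comp => [y _|]; first exact: iter_continuous.
  exact: mdist_ball_open.
apply/seteqP; split=> [y /bowen_dist_ltP[_ h] m /= mM|y h]; first exact: h.
by apply/bowen_dist_ltP; split.
Qed.

Lemma bowen_neighbourhood_open M (A : set X) e :
  open [set y | exists2 a, A a & bowen_dist M a y < e].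
Proof.
rewrite (_ : [set y | _] = \bigcup_(a in A) [set y | bowen_dist M a y < e]).
  by apply: bigcup_open => a _; exact: bowen_ball_open.
by apply/seteqP; split=> y [a]; exists a.
Qed.

(** Thickening each class by h in the Bowen metric makes it open, at the price of
    2h on its diameter. *)
Lemma open_coverable_small_pieces M (K : set X) e h n : 0 < h ->
  small_pieces (bowen_dist M) K e n%:R ->
  open_coverable (bowen_dist M) K (e + 2 * h) n.
Proof.
move=> h0 [k kn [c [cn cd]]].
pose U (i : 'I_n) :=
  [set y | exists2 a, [set a | K a /\ c a = i] a & bowen_dist M a y < h].
rewrite -[n]card_ord; apply: (@open_coverable_fin _ _ _ _ _ _ U).
- by move=> i; exact: bowen_neighbourhood_open.
- move=> i x y [a [Ka ca] ax] [b [Kb cb] bY].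
  have ab : bowen_dist M a b <= e by apply: cd => //; rewrite ca cb.
  have := bowen_dist_triangle M a x y; have := bowen_dist_triangle M b a y.
  rewrite (bowen_dist_sym M x a); lra.
- move=> x Kx; have cxn : (c x < n)%N.
    by apply: leq_trans (cn _ Kx) _; rewrite -(ler_nat R).
  by exists (Ordinal cxn) => //; exists x => //; rewrite bowen_distxx.
Qed.

Lemma small_pieces_setT M e : 0 < e ->
  exists2 K : R, 1 <= K & small_pieces (bowen_dist M) [set: X] e K.
Proof.
move=> e0.
have [|s sP] := @compact_finite_subfamily X setT
    (fun x => [set y | bowen_dist M x y < e / 2]) (@dyn_compact R X).
  move=> x _; apply: open_nbhs_nbhs; split; first exact: bowen_ball_open.
  by rewrite /= bowen_distxx divr_gt0.
have [c cP] : {c : X -> X & forall y, c y \in s /\ bowen_dist M (c y) y < e / 2}.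
  apply: (@choice _ _ (fun y z => z \in s /\ bowen_dist M z y < e / 2)) => y.
  by have [z zs zy] := sP y I; exists z.
exists ((size s)%:R + 1); first by rewrite lerDr.
exists (size s); first by rewrite lerDl.
exists (fun y => index (c y) s); split=> [y _|y z _ _ h].
  by rewrite index_mem; have [] := cP y.
have cyz : c y = c z by rewrite -(nth_index y (cP y).1) h nth_index// (cP z).1.
have := bowen_dist_triangle M (c y) y z; rewrite (bowen_dist_sym M y (c y)).
have [_] := cP y; have [_] := cP z; rewrite cyz; lra.
Qed.

End bowen.

(** * Growth of the covering numbers of Bowen balls *)

Section growth.
Context {R : realType} (X : dynSystem R).
Let T := @dyn_map R X.
Local Open Scope ereal_scope.

Definition log_growth (r rho : R) (M : nat) : \bar R :=
  ereal_sup [set lne (covering_number (bowen_dist M) (bowen_ball M x r) rho)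
            | x in [set: X]].

(** All estimates on the extended-real growth go through this reformulation,
    which involves neither suprema nor logarithms. *)
Lemma log_growth_leP r rho M (b : R) : log_growth r rho M <= b%:E <->
  forall x : X, exists n : nat, [/\ (1 <= n)%N, (n%:R <= expR b)%R
    & open_coverable (bowen_dist M) (bowen_ball M x r) rho n].
Proof.
have lneb (x : X) : lne (covering_number (bowen_dist M) (bowen_ball M x r) rho)
    <= b%:E = (covering_number (bowen_dist M) (bowen_ball M x r) rho <= (expR b)%:E).
  rewrite -lee_expeR lneK// in_itv/= leey andbT.
  exact: le_trans (covering_number_ge1 _ _ _).
split=> [/ereal_supP h x|h].
  by apply/covering_number_leP; rewrite -lneb; apply: h; exists x.
apply/ereal_supP => _ [x _ <-]; rewrite lneb; apply/covering_number_leP.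
exact: h.
Qed.

Lemma log_growth_ge0 (x : X) r rho M : 0 <= log_growth r rho M.
Proof.
apply: (@le_trans _ _ (lne (covering_number (bowen_dist M) (bowen_ball M x r) rho))).
  by rewrite lne_ge0 covering_number_ge1.
by apply: ereal_sup_ubound; exists x.
Qed.

Lemma log_growth_lty r rho M : (0 < rho)%R ->
  exists b : R, log_growth r rho M <= b%:E.
Proof.
move=> rho0.
have r20 : (0 < rho / 2)%R by rewrite divr_gt0.
have [K K1 [n nK nP]] := @small_pieces_setT R X M _ r20.
(* n may be 0 on an empty space, but covering numbers count at least one set. *)
exists (ln (n.+1)%:R)%R; apply/log_growth_leP => x; exists n.+1; split=> //.
  by rewrite lnK// posrE ltr0n.
have -> : (rho = rho / 2 + 2 * (rho / 4))%R by lra.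
apply: open_coverable_small_pieces; first by rewrite divr_gt0.
have [c [cn cd]] := nP; exists n; first by rewrite ler_nat.
by exists c; split=> [y _|y z _ _]; [exact: cn|exact: cd].
Qed.

(** A Bowen ball of length M + N is the part of the ball of length M around x
    that T^M sends to the ball of length N around T^M x; covers of these two
    balls are intersected. *)
Lemma log_growthD r rho M N (a b : R) : log_growth r rho M <= a%:E ->
  log_growth r rho N <= b%:E -> log_growth r rho (M + N) <= (a + b)%:E.
Proof.
move=> /log_growth_leP hM /log_growth_leP hN; apply/log_growth_leP => x.
have [m [m1 ma [U [oU dU KU]]]] := hM x.
have [n [n1 nb [V [oV dV KV]]]] := hN (iter M T x).
exists (m * n)%N; split; first by rewrite muln_gt0 m1.
  by rewrite expRD natrM ler_pM.
have -> : (m * n = #|{: 'I_m * 'I_n}|)%N by rewrite card_prod !card_ord.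
apply: (@open_coverable_fin _ _ _ _ _ _
    (fun ij => U ij.1 `&` (iter M T @^-1` V ij.2))).
- move=> [i j]; apply: openI; first exact: oU.
  by apply: open_comp => [y _|]; [exact: iter_continuous|exact: oV].
- move=> [i j] y z [/= Uy Vy] [/= Uz Vz]; apply/bowen_distD_leP; split.
    by have /diam_leP := dU i; exact.
  by have /diam_leP := dV j; exact.
- move=> y /bowen_distD_leP[/KU[i _ Ui] /KV[j _ Vj]].
  by exists (i, j).
Qed.

(** The local entropy of a nonempty system when rho > 0, see [local_entropyE]. *)
Definition log_growth_rate (r rho : R) : R :=
  inf [set (fine (log_growth r rho n) / n%:R)%R | n in [set n | (0 < n)%N]].

Lemma log_growth_fineK (x : X) r rho M : (0 < rho)%R ->
  (fine (log_growth r rho M))%:E = log_growth r rho M.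
Proof.
move=> rho0; apply: fineK; have [b hb] := log_growth_lty r M rho0.
rewrite ge0_fin_numE; first exact: le_lt_trans hb (ltry _).
exact: log_growth_ge0 x _ _ _.
Qed.

Lemma local_entropyE (x : X) r rho : (0 < rho)%R ->
  local_entropy X r rho = (log_growth_rate r rho)%:E.
Proof.
move=> rho0; apply/cvg_lim => //.
have -> : (fun M : nat => (M%:R^-1)%:E * log_growth r rho M) =
    EFin \o (fun n => (fine (log_growth r rho n) / n%:R)%R).
  apply/funext => M /=.
  by rewrite EFinM (log_growth_fineK x)// muleC.
apply: cvg_EFin; first exact: nearW.
apply: fekete => [n|m n]; first by apply: fine_ge0; exact: log_growth_ge0 x _ _ _.
rewrite -lee_fin (log_growth_fineK x)//; apply: log_growthD;
  by rewrite (log_growth_fineK x).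
Qed.

Lemma log_growth_rate_le (x : X) r rho M (b : R) : (0 < rho)%R -> (0 < M)%N ->
  log_growth r rho M <= b%:E -> (log_growth_rate r rho <= b / M%:R)%R.
Proof.
move=> rho0 M0 hb; apply: le_trans (fekete_inf_le _ M0) _.
  by move=> n; apply: fine_ge0; exact: log_growth_ge0 x _ _ _.
by rewrite ler_wpM2r// -lee_fin (log_growth_fineK x).
Qed.

Lemma le_log_growth_rate (x : X) r rho (c : R) : (0 < rho)%R ->
  (forall M b, (0 < M)%N -> log_growth r rho M <= b%:E -> (c <= b / M%:R)%R) ->
  (c <= log_growth_rate r rho)%R.
Proof.
move=> rho0 h; apply: le_fekete_inf => M M0; apply: h => //.
by rewrite (log_growth_fineK x).
Qed.

(** Every supremum is then -oo, so that empty systems share the same sequence. *)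
Lemma local_entropy_empty r rho : (X -> False) ->
  local_entropy X r rho = limn (fun M : nat => (M%:R^-1)%:E * (-oo : \bar R)).
Proof.
move=> X0; congr (limn _); apply/funext => M; congr (_ * _).
rewrite (_ : [set _ | _ in _] = set0) ?ereal_sup0//.
by apply/seteqP; split=> // y [x _]; case: (X0 x).
Qed.

End growth.

(** * Orbits stay near the non-wandering set *)

Section wandering.
Context {R : realType} (X : dynSystem R).
Let T := @dyn_map R X.

(** Points outside U are wandering, so they have neighbourhoods V with T^m V
    disjoint from V for m >= 1, and finitely many of these cover the complement
    of U. Any orbit meets each of them at most once, so their number bounds the
    visits outside U, whatever the orbit and the sampling step L. *)
Lemma wandering_escape_bounded (U : set X) : open U -> @nonwandering R X `<=` U ->
  exists k : nat, forall (x : X) (L n : nat), (0 < L)%N ->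
    (\sum_(j < n) `[< ~ U (iter (j * L) T x) >] <= k)%N.
Proof.
move=> oU OU.
have [V VP] : {V : X -> set X & forall x, (~ U x -> nbhs x (V x)) /\
    forall n y, (0 < n)%N -> V x y -> ~ V x (iter n T y)}.
  apply: (@choice _ _ (fun x W => (~ U x -> nbhs x W) /\
    forall n y, (0 < n)%N -> W y -> ~ W (iter n T y))) => x.
  have [Ux|nUx] := pselect (U x); first by exists set0; split.
  have /existsNP[W /not_implyP[oW /not_implyP[Wx noW]]] :
      ~ @nonwandering R X x by move=> /OU.
  exists W; split=> [_|n y n0 Wy WTy]; first exact: open_nbhs_nbhs.
  by apply: noW; exists n => //; exists (iter n T y); split=> //; exists y.
have cU : compact (~` U).
  by apply: subclosed_compact (@dyn_compact R X) _ => //; exact: open_closedC.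
have [s sP] := compact_finite_subfamily cU (fun x => (VP x).1).
have [c cP] : {c : X -> X & forall x, ~ U x -> c x \in s /\ V (c x) x}.
  apply: (@choice _ _ (fun x y => ~ U x -> y \in s /\ V y x)) => x.
  have [Ux|nUx] := pselect (U x); first by exists x.
  by have [y ys Vy] := sP x nUx; exists y.
exists (size s) => x L n L0.
pose A := [set j : 'I_n | `[< ~ U (iter (j * L) T x) >]]%SET.
have -> : (\sum_(j < n) `[< ~ U (iter (j * L) T x) >] = #|A|)%N.
  rewrite -sum1_card big_mkcond/= [RHS]big_mkcond/=; apply: eq_bigr => j _.
  by rewrite inE; case: asboolP.
pose f (j : 'I_n) := c (iter (j * L) T x).
rewrite cardE -(size_map f); apply: uniq_leq_size; last first.
  by move=> y /mapP[j]; rewrite mem_enum !inE => nUj ->; have [] := cP _ nUj.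
(* Two visits i < j to the same V would put T^((j - i) L) of a point of V back
   in V. *)
have neq (i j : 'I_n) : i \in A -> j \in A -> (i < j)%N -> f i <> f j.
  rewrite !inE => nUi nUj ij fij.
  have [[_ Vi] [_ Vj]] := (cP _ nUi, cP _ nUj).
  have [_ /(_ ((j - i) * L)%N _ _ Vi)] := VP (f i); apply.
    by rewrite muln_gt0 subn_gt0 ij.
  by rewrite fij -iterD -mulnDl subnK// ltnW.
rewrite map_inj_in_uniq ?enum_uniq// => i j; rewrite !mem_enum => iA jA fij.
apply: val_inj; have [ij|ji|//] := ltngtP i j.
- by case: (neq i j iA jA ij).
- by case: (neq j i jA iA ji).
Qed.

Lemma bowen_dist_nonwandering M (x y : nonwandering_system X) :
  bowen_dist M x y = bowen_dist M (set_val x : X) (set_val y : X).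
Proof.
have iterE m (z : nonwandering_system X) :
    set_val (iter m (@dyn_map R (nonwandering_system X)) z) = iter m T (set_val z).
  by elim: m => //= m <-.
apply: eq_bigr => m _; rewrite -!iterE.
by [].
Qed.

Lemma log_growth_nonwandering_le r rho M (b : R) :
  (log_growth X r rho M <= b%:E)%E ->
  (log_growth (nonwandering_system X) r rho M <= b%:E)%E.
Proof.
move=> /log_growth_leP h; apply/log_growth_leP => x.
have [n [n1 nb [U [oU dU KU]]]] := h (set_val x); exists n; split=> //.
exists (fun i => set_val @^-1` U i); split=> [i|i|y].
- apply: open_comp => [z _|]; [exact: initial_continuous|exact: oU].
- apply/diam_leP => y z Uy Uz; rewrite bowen_dist_nonwandering.
  by have /diam_leP := dU i; exact.
- rewrite /bowen_ball /= bowen_dist_nonwandering => xy.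
  by have [i _ Ui] := KU (set_val y) xy; exists i.
Qed.

End wandering.

(** * Covering Bowen balls window by window *)

Section window.
Context {R : realType} (X : dynSystem R).
Let T := @dyn_map R X.
Context (U : set X) (L : nat) (r e G0 K G A : R).
Context (good : forall x, small_pieces (bowen_dist L)
  [set y | [/\ U x, U y & bowen_dist L x y <= r]] e G0).
Context (bad : small_pieces (bowen_dist L) [set: X] e K).
Context (e0 : 0 <= e) (G00 : 0 <= G0) (GG : G0 <= G) (A1 : 1 <= A)
  (AK : K <= A * (G - G0)).

Let bad_window x y j := `[< ~ (U (iter (j * L) T x) /\ U (iter (j * L) T y)) >].

(** The number N(n, b) of pieces needed for n windows, at most b of them bad,
    satisfies N(n + 1, b) <= G0 N(n, b) + K N(n, b - 1) according to whether the
    last window is bad. For any G > G0 this recursion is solved by G^n A^b as soon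
    as K <= A (G - G0): the unknown positions of the bad windows are absorbed by
    the arbitrarily small excess of G over G0. *)
Lemma small_pieces_bowen_ball_windows (x : X) n b :
  small_pieces (bowen_dist (n * L))
    [set y | bowen_dist (n * L) x y <= r /\ (\sum_(j < n) bad_window x y j <= b)%N]
    e (G ^+ n * A ^+ b).
Proof.
have G_ge0 : 0 <= G by exact: le_trans GG.
have A_ge0 : 0 <= A by exact: le_trans A1.
elim: n b => [|n IH] b.
  apply: small_pieces1 => [|y z _ _]; first by rewrite mul1r exprn_ege1.
  by apply/bowen_dist_leP; split.
pose E b' := [set y | bowen_dist (n * L) x y <= r /\
  (\sum_(j < n) bad_window x y j <= b')%N].
pose x' := iter (n * L) T x.
have glue y z : bowen_dist (n * L) y z <= e ->
    bowen_dist L (iter (n * L) T y) (iter (n * L) T z) <= e ->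
    bowen_dist (n.+1 * L) y z <= e.
  by move=> h1 h2; rewrite mulSn addnC; apply/bowen_distD_leP.
have goodP := small_piecesI glue (IH b)
  (small_pieces_preimage (iter (n * L) T) (good x')).
have badP b' := small_piecesI glue (IH b')
  (small_pieces_preimage (iter (n * L) T) bad).
case: b goodP => [|b] goodP.
(* Without any bad window left, the last window is good. *)
- apply: (@small_pieces_le _ _ _ _ _ (G ^+ n * A ^+ 0 * G0)).
    by rewrite !expr0 !mulr1 exprSr ler_wpM2l// exprn_ge0.
  have [k kB [c [cn cd]]] := goodP; exists k => //; exists c.
  have sub y : bowen_dist (n.+1 * L) x y <= r /\
      (\sum_(j < n.+1) bad_window x y j <= 0)%N ->
      (E 0%N `&` iter (n * L) T @^-1`
        [set y | [/\ U x', U y & bowen_dist L x' y <= r]]) y.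
    rewrite mulSn addnC big_ord_recr /= => -[/bowen_distD_leP[d1 d2]].
    rewrite leqn0 addn_eq0 => /andP[/eqP s0]; rewrite eqb0 => /asboolPn/contrapT[Ux Uy].
    by split; [split=> //; rewrite s0|split].
  by split=> [y /sub/cn//|y z /sub Ey /sub Ez]; exact: cd.
- apply: (@small_pieces_le _ _ _ _ _
    (G ^+ n * A ^+ b.+1 * G0 + G ^+ n * A ^+ b * K)).
    have -> : G ^+ n.+1 * A ^+ b.+1 =
      G ^+ n * A ^+ b.+1 * G0 + G ^+ n * A ^+ b * (A * (G - G0)).
      by rewrite !exprS; ring.
    by rewrite lerD2l ler_wpM2l// mulr_ge0// exprn_ge0.
  apply: small_piecesU goodP (badP b) => y [].
  rewrite mulSn addnC big_ord_recr /= => /bowen_distD_leP[d1 d2].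
  rewrite {2}/bad_window; case: asboolP => [_|/contrapT[Ux Uy]].
    by rewrite addn1 ltnS => hb; right; split.
  by rewrite addn0 => hb; left; split; split.
Qed.

End window.

(** * Comparison of the local entropies *)

Section comparison.
Context {R : realType} (X : dynSystem R).
Let T := @dyn_map R X.
Let Om := nonwandering_system X.

Let near_Om (L : nat) (h : R) : set X :=
  [set y | exists2 a, @nonwandering R X a & bowen_dist L a y < h].

(** Each y is replaced by a point q y of Om that d_L-follows it within h: the
    points q y lie in a ball of Om of radius r + 2h, and the labels of a cover of
    that ball, pulled back by q, give classes whose size grows by 2h. *)
Lemma small_pieces_near_nonwandering L r rho h (b : R) (x : X) :
  (log_growth Om (r + 2 * h) rho L <= b%:E)%E ->
  small_pieces (bowen_dist L)
    [set y | [/\ near_Om L h x, near_Om L h y & bowen_dist L x y <= r]]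
    (rho + 2 * h) (expR b).
Proof.
move=> /log_growth_leP hb.
have [[a Oa ax]|nx] := pselect (near_Om L h x); last first.
  by apply: small_pieces0; [exact: expR_ge0|move=> y [/nx]].
pose p : Om := exist _ a (mem_set Oa).
have [q qP] : {q : X -> Om & forall y, near_Om L h y ->
    bowen_dist L (set_val (q y) : X) y < h}.
  apply: (@choice _ _ (fun y q => near_Om L h y -> bowen_dist L (set_val q : X) y < h)).
  move=> y; have [[z Oz zy]|ny] := pselect (near_Om L h y); last by exists p.
  by exists (exist _ z (mem_set Oz)).
have [n [n1 nb /small_pieces_open_coverable[k kn [c [cn cd]]]]] := hb p.
have ball y : near_Om L h y -> bowen_dist L x y <= r ->
    bowen_ball L p (r + 2 * h) (q y).
  move=> Uy xy; rewrite /bowen_ball /= bowen_dist_nonwandering.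
  have := bowen_dist_triangle L x a (set_val (q y)).
  have := bowen_dist_triangle L y x (set_val (q y)).
  have := qP y Uy; rewrite (bowen_dist_sym L _ y) /=; lra.
exists k; first exact: le_trans nb.
exists (c \o q); split=> [y [_ Uy xy]|y z [_ Uy xy] [_ Uz xz] cyz] /=.
  by apply: cn; exact: ball.
have := cd _ _ (ball _ Uy xy) (ball _ Uz xz) cyz.
rewrite bowen_dist_nonwandering.
have := bowen_dist_triangle L (set_val (q y)) y z.
have := bowen_dist_triangle L (set_val (q z)) (set_val (q y)) z.
have := qP y Uy; have := qP z Uz; rewrite (bowen_dist_sym L _ y); lra.
Qed.

(** Otherwise all the times of an orbit would be visits outside U = set0. *)
Lemma nonwandering_nonempty (x : X) : exists y, @nonwandering R X y.
Proof.
apply: contrapT => /forallNP no.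
have [k /(_ x 1%N k.+1 isT)] := wandering_escape_bounded (@open0 X) (fun y Oy => no y Oy).
rewrite (eq_bigr (fun=> 1%N)) ?sum1_card ?card_ord ?ltnn// => j _.
by rewrite asboolT.
Qed.

(** With h = rho/8, replacing points by points of Om enlarges the radius r to
    r + 2h <= 2r, and the size rho/2 of the pieces of Om becomes rho/2 + 2h near
    Om, then rho/2 + 4h = rho once the pieces are made open. *)
Lemma log_growth_rate_le_nonwandering (x0 : X) r rho : 0 < rho -> rho < r ->
  log_growth_rate X r rho <= log_growth_rate Om (2 * r) (rho / 2).
Proof.
move=> rho0 rhor; have [w Ow] := nonwandering_nonempty x0.
have rho2 : 0 < rho / 2 by lra.
apply: (@le_log_growth_rate _ _ (exist _ w (mem_set Ow) : Om)) => // L b L0 hb.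
set S := log_growth_rate X r rho.
have LR : 0 < L%:R :> R by rewrite ltr0n.
rewrite ler_pdivlMr// leNgt; apply/negP => bS.
pose h := rho / 8.
have h0 : 0 < h by rewrite divr_gt0.
have hb' : (log_growth Om ((2 * r - 2 * h) + 2 * h) (rho / 2) L <= b%:E)%E.
  by rewrite subrK.
pose U := near_Om L h.
have oU : open U by exact: bowen_neighbourhood_open.
have OU : @nonwandering R X `<=` U by move=> a Oa; exists a; rewrite ?bowen_distxx.
have [k kP] := wandering_escape_bounded oU OU.
pose e := rho / 2 + 2 * h.
have e0 : 0 < e by rewrite /e; lra.
have [K K1 KP] := @small_pieces_setT R X L e e0.
have good x : small_pieces (bowen_dist L)
    [set y | [/\ U x, U y & bowen_dist L x y <= r]] e (expR b).
  have [n nB [c [cn cd]]] := small_pieces_near_nonwandering x hb'.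
  exists n => //; exists c.
  have rr : r <= 2 * r - 2 * h by rewrite /h; lra.
  split=> [y [Ux Uy xy]|y z [Ux Uy xy] [_ Uz xz]].
    by apply: cn; split=> //; exact: le_trans xy rr.
  by apply: cd; split=> //; [exact: le_trans xy rr|exact: le_trans xz rr].
(* If S L exceeded b, the factor G of [small_pieces_bowen_ball_windows] could be
   taken strictly between exp b and exp (S L), contradicting [bound] below. *)
pose b' := (b + S * L%:R) / 2.
have Gd : 0 < expR b' - expR b by rewrite subr_gt0 ltr_expR /b'; lra.
pose A := 1 + K / (expR b' - expR b).
have A1 : 1 <= A by rewrite lerDl divr_ge0// ?ltW//; lra.
have AK : K <= A * (expR b' - expR b).
  by rewrite mulrDl mul1r divfK ?gt_eqF// lerDr ltW.
have GG : expR b <= expR b' by rewrite ltW// -subr_gt0.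
have A0 : 0 < A by exact: lt_le_trans A1.
have bound n : (0 < n)%N -> S <= (n%:R * b' + (2 * k)%:R * ln A) / (n * L)%:R.
  move=> n0; apply: (log_growth_rate_le x0) => //; first by rewrite muln_gt0 n0.
  apply/log_growth_leP => x.
  have [m mN [c [cm cd]]] := small_pieces_bowen_ball_windows good KP (ltW e0) (expR_ge0 b)
    GG A1 AK x n (2 * k).
  have ballE y : bowen_ball (n * L) x r y -> [set y | bowen_dist (n * L) x y <= r /\
      (\sum_(j < n) `[< ~ (U (iter (j * L) T x) /\ U (iter (j * L) T y)) >]
        <= 2 * k)%N] y.
    move=> xy; split=> //; rewrite mul2n -addnn.
    apply: leq_trans (leq_add (kP x L n L0) (kP y L n L0)).
    rewrite -big_split /=; apply: leq_sum => j _.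
    by case: asboolP => //; case: asboolP => //; case: asboolP => //; tauto.
  have xx : bowen_ball (n * L) x r x by rewrite /bowen_ball /= bowen_distxx; lra.
  exists m; split.
  - by apply: leq_ltn_trans (cm _ (ballE _ xx)).
  - apply: le_trans mN _; rewrite expRD !expRM_natl lnK//.
  - have -> : rho = e + 2 * h by rewrite /e /h; lra.
    apply: open_coverable_small_pieces => //; exists m => //; exists c.
    by split=> [y /ballE/cm//|y z /ballE Ey /ballE Ez]; exact: cd.
pose C := (2 * k)%:R * ln A.
have C0 : 0 <= C by rewrite mulr_ge0// ln_ge0.
have d0 : 0 < S * L%:R - b' by rewrite /b'; lra.
have nC := archi_boundP (divr_ge0 C0 (ltW d0)).
set n := Num.bound _ in nC.
have n0 : (0 < n)%N by rewrite -(ltr0n R) (le_lt_trans _ nC)// divr_ge0// ltW.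
have := bound n n0; rewrite ler_pdivlMr ?ltr0n ?muln_gt0 ?n0// natrM.
rewrite -/C; move: nC; rewrite ltr_pdivrMr//; lra.
Qed.

Lemma local_entropy_le_nonwandering r rho : 0 < rho -> rho < r ->
  (local_entropy X r rho <= local_entropy Om (2 * r) (rho / 2))%E.
Proof.
move=> rho0 rhor; have [[x _]|/forallNP X0] := pselect (exists x : X, True).
  have [w Ow] := nonwandering_nonempty x.
  rewrite (local_entropyE x)// (local_entropyE (exist _ w (mem_set Ow) : Om)) ?divr_gt0//.
  by rewrite lee_fin log_growth_rate_le_nonwandering.
rewrite !local_entropy_empty// => x; last exact: (X0 x).
exact: (X0 (set_val x)).
Qed.

Lemma local_entropy_nonwandering_le r rho : 0 < rho ->
  (local_entropy Om r rho <= local_entropy X r rho)%E.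
Proof.
move=> rho0; have [[x _]|/forallNP X0] := pselect (exists x : X, True).
  have [w Ow] := nonwandering_nonempty x.
  pose p : Om := exist _ w (mem_set Ow).
  rewrite (local_entropyE x)// (local_entropyE p)//.
  rewrite lee_fin; apply: (le_log_growth_rate x) => // M b M0 hb.
  by apply: (log_growth_rate_le p) => //; exact: log_growth_nonwandering_le.
rewrite !local_entropy_empty// => x; first exact: (X0 x).
exact: (X0 (set_val x)).
Qed.

End comparison.

Theorem proposition3p5 (R : realType) (X : dynSystem R) :
  mdimA X = mdimA (nonwandering_system X).
Proof.
congr (ereal_inf (_ @` _)); apply/seteqP; split=> s [s0 [C C0 hC]]; split=> //.
- exists C => // r rho /andP[rho0 rhor]; apply: le_trans (hC r rho _).
    by rewrite lee_expeR local_entropy_nonwandering_le.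
  by rewrite rho0.
- exists (C * 4 `^ s); first by rewrite mulr_gt0// powR_gt0.
  move=> r rho /andP[rho0 rhor].
  have -> : C * 4 `^ s * (r / rho) `^ s = C * (2 * r / (rho / 2)) `^ s.
    rewrite -mulrA -powRM//; last by rewrite divr_ge0//; lra.
    by congr (_ * _ `^ _); field; rewrite gt_eqF.
  apply: le_trans (hC (2 * r) (rho / 2) _); last by apply/andP; split; lra.
  by rewrite lee_expeR local_entropy_le_nonwandering.
Qed.
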